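(* Let $n\ge 1$ and let $\lambda=(s_1^{m_1},\dots,s_t^{m_t})\vdash n$ with $s_1>\cdots>s_t>0$, $m_i\ge 1$, and $s_{t+1}:=0$. For $1\le i\le t$ define $\alpha_i=1$ if $m_i=1$ and $\alpha_i=0$ otherwise, and $\beta_i=1$ if $s_i-s_{i+1}=1$ and $\beta_i=0$ otherwise. Then the ordered local transfer type $$\mathfrak t(\lambda)=\bigl(t;\alpha_1,\dots,\alpha_t;\beta_1,\dots,\beta_t\bigr)$$ completely determines the following objects (the graphs being determined up to isomorphism): (1) the local admissibility graph $B(\lambda)$; (2) the induced neighborhood graph $\mathcal N(\lambda)=G_n[N_{G_n}(\lambda)]$; (3) the degree of $\lambda$ in $G_n$; (4) the local clique number $\omega_{\mathrm{loc}}(\lambda)$; (5) the local simplex dimension $\dim_{\mathrm{loc}}(\lambda)$. More precisely: - $B(\lambda)$ is obtained from the complete bipartite graph $K_{t,t+1}$ with left vertices $1,\dots,t$ and right vertices $1,\dots,t+1$ by deleting exactly the edges joining left vertex $i$ to right vertex $i$ for those $i\in\{1,\dots,t\}$ with $\alpha_i=1$, and the edges joining left vertex $i$ to right vertex $i+1$ for those $i\in\{1,\dots,t\}$ with $\beta_i=1$; - $\mathcal N(\lambda)\cong L(B(\lambda))$, the line graph of $B(\lambda)$; - every clique in $G_n$ containing $\lambda$ is either of star type or of top type; - one has $$\deg_{G_n}(\lambda)=t(t+1)-\sum_{i=1}^t\alpha_i-\sum_{i=1}^t\beta_i$$ and $$\dim_{\mathrm{loc}}(\lambda)=\max\Bigl\{\max_{1\le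 i\le t}(t+1-\alpha_i-\beta_i),\ \max_{1\le j\le t+1}(t-\alpha_j-\beta_{j-1})\Bigr\},$$ with the conventions $\beta_0:=0$ and $\alpha_{t+1}:=0$.
   Context: A partition $\lambda\vdash n$ is written in block form $\lambda=(s_1^{m_1},\dots,s_t^{m_t})$, where $s_1>\dots>s_t>0$ are its distinct part sizes and $m_i\ge1$ is the multiplicity of $s_i$; put $s_{t+1}:=0$. Corners. The Ferrers diagram of $\lambda$ has exactly $t$ removable corners $c_1,\dots,c_t$, where $c_i$ is the last cell of the last row of length $s_i$, and exactly $t+1$ addable corners $a_1,\dots,a_{t+1}$, where for $1\le j\le t$ the corner $a_j$ is the position just after the end of the first row of length $s_j$ (adding it increases one part of size $s_j$ to $s_j+1$), and $a_{t+1}$ corresponds to creating a new part $1$ (a new row, of previous length $0$). Transfers. For $1\le i\le t$, $1\le j\le t+1$, the transfer $\lambda(c_i\to a_j)$ decreases by $1$ the length of the row containing $c_i$, increases by $1$ the length of the row of $a_j$ (if these are the same row, the row length is unchanged), and reorders the row lengths (discarding zeros). The transfer is called admissible if the resulting partition is different from $\lambda$; then the resulting partition is denoted $\lambda_{ij}=\lambda(c_i\to a_j)$. Partition graph. $G_n$ is the simple graph whose vertices are the partitions of $n$, with two distinct partitions $\mu,\nu$ adjacent if $\nu$ is obtained from $\mu$ by an admissible transfer. $N_{G_n}(\lambda)$ is the set of neighbors of $\lambda$, and $G_n[N_{G_n}(\lambda)]$ the subgraph induced on it. Local admissibility graph. $B(\lambda)$ is the bipartite graph with left vertex set $\{1,\dots,t\}$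 and right vertex set (a disjoint copy of) $\{1,\dots,t+1\}$, in which left vertex $i$ and right vertex $j$ are adjacent iff the transfer $\lambda(c_i\to a_j)$ is admissible. Line graph. $L(B)$ has as vertices the edges of $B$, two distinct edges being adjacent iff they share an endpoint. Cliques. A clique is a set of pairwise adjacent vertices. A clique $C$ of $G_n$ containing $\lambda$ is of star type if there is a fixed $i\in\{1,\dots,t\}$ such that every vertex of $C\setminus\{\lambda\}$ equals $\lambda_{ij}$ for some $j$ with $\lambda(c_i\to a_j)$ admissible; it is of top type if there is a fixed $j\in\{1,\dots,t+1\}$ such that every vertex of $C\setminus\{\lambda\}$ equals $\lambda_{ij}$ for some $i$ with $\lambda(c_i\to a_j)$ admissible. Local clique invariants. $\omega_{\mathrm{loc}}(\lambda):=\max\{|C| : \lambda\in C,\ C\text{ a clique in }G_n\}$ and $\dim_{\mathrm{loc}}(\lambda):=\omega_{\mathrm{loc}}(\lambda)-1$. ''$\mathfrak t(\lambda)$ completely determines'' means: if partitions $\lambda,\mu$ (of possibly different integers) satisfy $\mathfrak t(\lambda)=\mathfrak t(\mu)$, then the corresponding graphs in (1), (2) are isomorphic and the corresponding numbers in (3)-(5) are equal. *)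

(* Defs.v *)
From HB Require Import structures.
From mathcomp Require Import all_boot zify.

Set Implicit Arguments.
Unset Strict Implicit.
Unset Printing Implicit Defensive.

Record sgraph := SGraph {
  vertex :> finType;
  edge : rel vertex;
  edge_sym : symmetric edge;
  edge_irr : irreflexive edge
}.

Definition graph_iso (G H : sgraph) : Prop :=
  exists2 f : G -> H, bijective f & forall x y, edge (f x) (f y) = edge x y.

Definition neighbors (G : sgraph) (x : G) : {set G} := [set y | edge x y].

Definition degree (G : sgraph) (x : G) : nat := #|neighbors x|.

Definition edges (G : sgraph) : {set {set G}} :=
  [set e : {set G} | [exists x, exists y, edge x y && (e == [set x; y])]].

Definition clique (G : sgraph) (C : {set G}) : bool :=
  [forall x in C, forall y in C, (x != y) ==> edge x y].

Section Induced.
Variables (G : sgraph) (A : {set G}).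

Definition induced_edge : rel {x : G | x \in A} :=
  fun x y => edge (val x) (val y).

Lemma induced_sym : symmetric induced_edge.
Proof. by move=> x y; apply: edge_sym. Qed.

Lemma induced_irr : irreflexive induced_edge.
Proof. by move=> x; apply: edge_irr. Qed.

Definition induced : sgraph := SGraph induced_sym induced_irr.
End Induced.

Section LineGraph.
Variable G : sgraph.

Definition line_edge : rel {e : {set G} | e \in edges G} :=
  fun e f => (e != f) && (val e :&: val f != set0).

Lemma line_sym : symmetric line_edge.
Proof. by move=> e f; rewrite /line_edge eq_sym setIC. Qed.

Lemma line_irr : irreflexive line_edge.
Proof. by move=> e; rewrite /line_edge eqxx. Qed.

Definition line_graph : sgraph := SGraph line_sym line_irr.
End LineGraph.

(* The bipartite graph on the disjoint union 'I_a + 'I_b given by a relation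
   between the left and the right vertices. *)
Section Bipartite.
Variables (a b : nat) (R : 'I_a -> 'I_b -> bool).

Definition bip_edge : rel ('I_a + 'I_b)%type := fun x y =>
  match x, y with
  | inl i, inr j | inr j, inl i => R i j
  | _, _ => false
  end.

Lemma bip_sym : symmetric bip_edge.
Proof. by move=> [i|j] [k|l]. Qed.

Lemma bip_irr : irreflexive bip_edge.
Proof. by move=> [i|j]. Qed.

Definition bipartite : sgraph := SGraph bip_sym bip_irr.
End Bipartite.

Definition complete_bipartite (a b : nat) : sgraph :=
  bipartite (fun (_ : 'I_a) (_ : 'I_b) => true).

Definition is_intpart (n : nat) (s : seq nat) : bool :=
  [&& sorted geq s, 0 \notin s & sumn s == n].

Record intpart (n : nat) := Intpart { parts :> seq nat; partsP : is_intpart n parts }.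

HB.instance Definition _ n := [isSub for @parts n].
HB.instance Definition _ n := [Countable of intpart n by <:].

Section IntpartFinite.
Variable n : nat.

Definition intpart_code (p : intpart n) : {ffun 'I_n -> 'I_n.+1} :=
  [ffun i => inord (nth 0 p (val i))].

Definition intpart_decode (f : {ffun 'I_n -> 'I_n.+1}) : option (intpart n) :=
  insub [seq x <- [seq val (f i) | i <- enum 'I_n] | 0 < x].

Lemma nth_leq_sumn (s : seq nat) i : nth 0 s i <= sumn s.
Proof.
elim: s i => [|x s IHs] [|i] //=; first exact: leq_addr.
exact: leq_trans (IHs i) (leq_addl _ _).
Qed.

Lemma size_leq_sumn (s : seq nat) : 0 \notin s -> size s <= sumn s.
Proof.
elim: s => //= x s IHs; rewrite inE negb_or eq_sym -lt0n => /andP[x0 /IHs].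
lia.
Qed.

Lemma intpart_codeK : pcancel intpart_code intpart_decode.
Proof.
move=> p; rewrite /intpart_decode.
have /and3P[_ p0 /eqP sp] := partsP p.
have szp : size p <= n by apply: leq_trans (size_leq_sumn p0) _; rewrite sp.
have -> : [seq val (intpart_code p i) | i <- enum 'I_n] =
          p ++ nseq (n - size p) 0.
  apply: (@eq_from_nth _ 0) => [|i].
    by rewrite size_map size_enum_ord size_cat size_nseq subnKC.
  rewrite size_map size_enum_ord => ltin.
  rewrite (nth_map (Ordinal ltin)) ?size_enum_ord // ffunE /=.
  rewrite nth_enum_ord // inordK; last by rewrite ltnS -[X in _ <= X]sp nth_leq_sumn.
  rewrite nth_cat nth_nseq; case: ltnP => // /(nth_default 0) ->.
  by rewrite if_same.
rewrite filter_cat (eq_in_filter (a2 := predT)) => [|x px /=].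
  rewrite filter_predT; have -> : [seq x <- nseq (n - size p) 0 | 0 < x] = [::].
    by elim: (n - size p).
  by rewrite cats0; case: p {p0 sp szp} => s sP; rewrite insubT.
by rewrite lt0n; apply: contraNneq p0 => <-.
Qed.
End IntpartFinite.

HB.instance Definition _ n : isFinite (intpart n) :=
  PCanIsFinite (@intpart_codeK n).

Definition last_index (x : nat) (s : seq nat) : nat :=
  size s - (index x (rev s)).+1.

(* Everything indexed is 0-based: the index i < t stands for i+1.  The
   functions below are applied to (the list of parts of) a partition. *)

Section Blocks.
Variable la : seq nat.

(* Since la is weakly decreasing, so is undup la: it lists s_1 > ... > s_t. *)
Definition nblocks : nat := size (undup la).

(* bsize nblocks = 0, which is the convention s_{t+1} = 0. *)
Definition bsize (i : nat) : nat := nth 0 (undup la) i.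

Definition bmult (i : nat) : nat := count_mem (bsize i) la.

Definition removable_row (i : nat) : nat := last_index (bsize i) la.

(* For j = nblocks this is size la, the index of the new (empty) row. *)
Definition addable_row (j : nat) : nat := index (bsize j) la.

(* When both rows coincide the row length is unchanged, because the row of a
   removable corner is nonempty. *)
Definition transfer_rows (r a : nat) : seq nat :=
  mkseq (fun k => nth 0 la k - (k == r) + (k == a)) (size la).+1.

Definition transfer_seq (i j : nat) : seq nat :=
  sort geq [seq x <- transfer_rows (removable_row i) (addable_row j) | 0 < x].

Definition alpha (i : nat) : nat := bmult i == 1.

Definition beta (i : nat) : nat := bsize i - bsize i.+1 == 1.

Definition transfer_type : nat * seq nat * seq nat :=
  (nblocks, mkseq alpha nblocks, mkseq beta nblocks).
End Blocks.

Lemma last_index_lt x s : x \in s -> last_index x s < size s.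
Proof. by rewrite /last_index; case: s => // y s _; rewrite ltn_subrL. Qed.

Lemma nth_last_index x s : x \in s -> nth 0 s (last_index x s) = x.
Proof.
rewrite -mem_rev => xs; rewrite /last_index -nth_rev ?nth_index //.
by rewrite -(size_rev s) index_mem.
Qed.

Lemma index_last_index x s :
  x \in s -> index x s = last_index x s -> count_mem x s = 1.
Proof.
case/path.splitP => p1 p2; rewrite /last_index.
have -> : index x (rcons p1 x ++ p2) = index x p1.
  rewrite -cats1 -catA index_cat /= eqxx addn0; case: ifP => // /negbT.
  by move/memNindex.
rewrite rev_cat [index x (_ ++ _)]index_cat mem_rev size_cat size_rcons size_rev.
have lep1 := index_size x p1.
have [xp2|xp2] := boolP (x \in p2).
  have : index x (rev p2) < size p2 by rewrite -(size_rev p2) index_mem mem_rev.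
  move: lep1; move: (index _ _) (index _ _) (size _) (size _) => a b c d.
  by move=> le1 lt2 eqi; exfalso; lia.
rewrite rev_rcons /= eqxx addn0 => eqi.
have xp1 : x \notin p1 by rewrite -index_mem eqi addSn subSS addnK ltnn.
rewrite -cats1 !count_cat /= eqxx.
by rewrite (count_memPn xp1) (count_memPn xp2).
Qed.

Lemma bsize_in (la : seq nat) i : i < nblocks la -> bsize la i \in la.
Proof. by move=> lti; rewrite -mem_undup mem_nth. Qed.

Lemma sumn_mkseq f n : sumn (mkseq f n) = \sum_(k < n) f k.
Proof. by rewrite sumnE big_map -{1}[n]subn0 big_mkord. Qed.

Lemma count_mkseq (z : nat) f n : count_mem z (mkseq f n) = \sum_(k < n) (f k == z).
Proof. by rewrite -(sumn_mkseq (fun k => f k == z : nat)) -sumn_count -map_comp. Qed.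

Lemma sumn_filter_gt0 (s : seq nat) : sumn [seq x <- s | 0 < x] = sumn s.
Proof. by elim: s => //= -[|x] s IHs //=; rewrite IHs. Qed.

Lemma sum_ord_eq1 n a : a < n -> \sum_(k < n) (val k == a : nat) = 1.
Proof.
move=> lta; rewrite (bigD1 (Ordinal lta)) //= eqxx big1 // => k.
by rewrite -val_eqE /= => /negbTE ->.
Qed.

Lemma mkseq_nth0 (la : seq nat) : mkseq (nth 0 la) (size la).+1 = rcons la 0.
Proof.
by rewrite /mkseq -[in iota _ _]addn1 iotaD map_cat /= nth_default // cats1
           [map _ _](mkseq_nth 0 la).
Qed.

Lemma sumn_transfer_rows (la : seq nat) r a :
  0 < nth 0 la r -> a <= size la -> sumn (transfer_rows la r a) = sumn la.
Proof.
move=> r0 lea.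
have ltr : r < (size la).+1.
  by rewrite ltnS leqNgt; apply: contraL r0 => /ltnW/(nth_default 0) ->.
have sla : sumn la = \sum_(k < (size la).+1) nth 0 la k.
  by rewrite -sumn_mkseq mkseq_nth0 sumn_rcons addn0.
rewrite sla sumn_mkseq; apply: (@addnI 1); rewrite -{1}(sum_ord_eq1 ltr).
rewrite -(sum_ord_eq1 (a := a) (n := (size la).+1)) // -!big_split /=.
apply: eq_bigr => k _; case: eqP => [->|_] /=; lia.
Qed.

Lemma addable_row_le (la : seq nat) j : addable_row la j <= size la.
Proof. exact: index_size. Qed.

Lemma part_gt0 n (la : intpart n) x : x \in (la : seq nat) -> 0 < x.
Proof.
by have /and3P[_ l0 _] := partsP la; rewrite lt0n => lx; apply: contraNneq l0 => <-.
Qed.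

Lemma geq_total : total geq. Proof. by move=> x y; apply: leq_total. Qed.
Lemma geq_trans : transitive geq.
Proof. by move=> x y z /= yx xz; apply: leq_trans xz yx. Qed.
Lemma geq_anti : antisymmetric geq.
Proof. by move=> x y /=; rewrite andbC => /anti_leq. Qed.

Lemma transfer_intpart n (la : intpart n) i j :
  i < nblocks la -> is_intpart n (transfer_seq la i j).
Proof.
move=> lti; have /and3P[_ _ /eqP sla] := partsP la.
apply/and3P; split; first exact: sort_sorted geq_total _.
  by rewrite mem_sort mem_filter.
rewrite (perm_sumn (permEl (perm_sort _ _))) sumn_filter_gt0.
rewrite sumn_transfer_rows ?sla ?addable_row_le //.
by rewrite nth_last_index ?bsize_in // (part_gt0 (bsize_in lti)).
Qed.

Section Local.
Variables (n : nat) (la : intpart n).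

Definition transfer (i : 'I_(nblocks la)) (j : 'I_(nblocks la).+1) : intpart n :=
  Intpart (transfer_intpart j (ltn_ord i)).

Definition admissible (i : 'I_(nblocks la)) (j : 'I_(nblocks la).+1) : bool :=
  transfer i j != la.

Definition local_graph : sgraph := bipartite admissible.
End Local.

Definition intpart_edge (n : nat) : rel (intpart n) := fun mu nu =>
  (mu != nu) && [exists i, exists j, admissible i j && (nu == transfer (la := mu) i j)].

Lemma intpart_irr n : irreflexive (@intpart_edge n).
Proof. by move=> mu; rewrite /intpart_edge eqxx. Qed.

Lemma count_transfer_rows (la : seq nat) r a z :
  r < size la -> a <= size la -> r != a ->
  count_mem z (transfer_rows la r a) + (nth 0 la r == z) + (nth 0 la a == z)
  = count_mem z (rcons la 0) + ((nth 0 la r).-1 == z) + ((nth 0 la a).+1 == z).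
Proof.
move=> ltr lea neq; rewrite -mkseq_nth0 /transfer_rows !count_mkseq.
have ltr' : r < (size la).+1 by lia.
have lta' : a < (size la).+1 by lia.
pose R := Ordinal ltr'; pose A := Ordinal lta'.
have RA : A != R by rewrite eq_sym.
rewrite [in LHS](bigD1 R) //= [in LHS](bigD1 A) //=.
rewrite [in RHS](bigD1 R) //= [in RHS](bigD1 A) //=.
rewrite !eqxx (negbTE neq) [a == r]eq_sym (negbTE neq) subn0 addn0 subn1 addn1.
under eq_bigr => k /andP[kR kA].
  rewrite -[val k == r]/(k == R) -[val k == a]/(k == A) (negbTE kR) (negbTE kA).
  rewrite subn0 addn0; over.
set S := \sum_(k < _ | _) _.
by do 4!case: eqP => _ /=; lia.
Qed.

Lemma transfer_rows_id (la : seq nat) r :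
  0 < nth 0 la r -> transfer_rows la r r = rcons la 0.
Proof.
move=> r0; rewrite -mkseq_nth0; apply: eq_map => k /=.
by case: eqP => [->|_] /=; lia.
Qed.

Lemma sort_filter_intpart n (la : intpart n) s :
  {in [pred z | 0 < z], forall z, count_mem z s = count_mem z (la : seq nat)} ->
  sort geq [seq x <- s | 0 < x] = la.
Proof.
move=> eqc; have /and3P[sla l0 _] := partsP la.
apply: (sorted_eq geq_trans geq_anti) => //; first exact: sort_sorted geq_total _.
rewrite perm_sort; apply/allP => z _; rewrite /= count_filter; apply/eqP.
have [->|z0] := posnP z.
  rewrite (count_memPn l0) (eq_count (a2 := pred0)) ?count_pred0 //.
  by move=> x /=; case: x.
rewrite -eqc //; apply: eq_count => x /=.
by case: eqP => [->|].
Qed.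

Lemma nth_addable n (la : intpart n) (j : 'I_(nblocks la).+1) :
  nth 0 la (addable_row la j) = bsize la j.
Proof.
have [xl|xl] := boolP (bsize la j \in (la : seq nat)); first exact: nth_index.
rewrite /addable_row (memNindex xl) nth_default //.
have [lej|ltj] := leqP (nblocks la) j; first by rewrite /bsize nth_default.
by rewrite (bsize_in ltj) in xl.
Qed.

Lemma count_transfer n (la : intpart n) i j z :
  admissible (la := la) i j -> 0 < z ->
  count_mem z (transfer i j) + (bsize la i == z) + (bsize la j == z)
  = count_mem z (la : seq nat) + ((bsize la i).-1 == z) + ((bsize la j).+1 == z).
Proof.
move=> adm z0; have il := bsize_in (ltn_ord i).
have i0 := part_gt0 il.
have neq : removable_row la i != addable_row la j.
  apply: contraNneq adm => eqr; apply/eqP/val_inj => /=.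
  apply: sort_filter_intpart => y y0.
  rewrite -eqr transfer_rows_id ?nth_last_index // -cats1 count_cat /=.
  by move: y0; rewrite inE; case: y => //= y _; rewrite !addn0.
have := count_transfer_rows z (last_index_lt il) (addable_row_le la j) neq.
rewrite nth_last_index // nth_addable -cats1 count_cat /=.
have -> : (0 == z) = false by case: z z0.
rewrite !addn0 => <-; congr (_ + _ + _).
rewrite (permP (permEl (perm_sort _ _))) count_filter.
by apply: eq_count => x /=; case: eqP => [->|].
Qed.

Lemma bsize_index (la : seq nat) x : x \in la -> bsize la (index x (undup la)) = x.
Proof. by move=> xl; rewrite /bsize nth_index ?mem_undup. Qed.

Lemma intpart_edge_rev n (mu nu : intpart n) : intpart_edge mu nu -> intpart_edge nu mu.
Proof.
case/andP=> neq /existsP[i /existsP[j /andP[adm /eqP nuE]]].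
have cnt z (z0 : 0 < z) := count_transfer adm z0.
rewrite -nuE {adm} in cnt; move: (bsize mu i) (bsize mu j) (part_gt0 (bsize_in (ltn_ord i))) cnt.
move=> x y x0 cnt.
have [xy|xy] := eqVneq x y.+1.
  case/negP: neq; apply/eqP/val_inj => /=; have /and3P[sn n0 _] := partsP nu.
  have /and3P[sm m0 _] := partsP mu.
  apply: (sorted_eq geq_trans geq_anti) => //; apply/allP => z _ /=; apply/eqP.
  have [->|z0] := posnP z; first by rewrite (count_memPn n0) (count_memPn m0).
  by have := cnt z z0; rewrite xy /=; lia.
have yn : y.+1 \in (nu : seq nat).
  rewrite -has_pred1 has_count; have := cnt y.+1 isT.
  rewrite eqxx (negbTE xy); have -> : (y == y.+1) = false by lia.
  lia.
have lti : index y.+1 (undup nu) < nblocks nu by rewrite index_mem mem_undup.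
have ltj : index x.-1 (undup nu) < (nblocks nu).+1 by rewrite ltnS index_size.
pose i' := Ordinal lti; pose j' := Ordinal ltj.
have bi : bsize nu i' = y.+1 by rewrite bsize_index.
have bj : bsize nu j' = x.-1.
  have [xn|xn] := boolP (x.-1 \in (nu : seq nat)); first exact: bsize_index.
  rewrite /bsize /= memNindex ?mem_undup // nth_default //.
  apply/esym/eqP; apply: contraNT xn; rewrite -lt0n => x1.
  rewrite -has_pred1 has_count; have := cnt _ x1; rewrite eqxx.
  have -> : (x == x.-1) = false by lia.
  have [yx|_] := eqVneq y x.-1; last by lia.
  by case/negP: xy; lia.
have neqr : removable_row nu i' != addable_row nu j'.
  rewrite /removable_row /addable_row bi bj; have [e|ne] := eqVneq x.-1 y.+1.
    rewrite e; apply/eqP => /esym/(index_last_index yn).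
    have := cnt y.+1 isT; rewrite e eqxx.
    have -> : (y == y.+1) = false by lia.
    have -> : (x == y.+1) = false by lia.
    lia.
  apply: contra_neq ne => /(congr1 (nth 0 nu)); rewrite nth_last_index // => ->.
  have := nth_addable j'; rewrite /addable_row bj => ->.
  by [].
suff muE : mu = transfer i' j'.
  rewrite /intpart_edge eq_sym neq; apply/existsP; exists i'; apply/existsP.
  by exists j'; rewrite /admissible -muE neq eqxx.
apply/esym/val_inj => /=; apply: sort_filter_intpart => z; rewrite inE => z0.
have := count_transfer_rows z (last_index_lt (bsize_in lti)) (addable_row_le nu j') neqr.
rewrite -/(removable_row nu i') -/(val j').
move: (transfer_rows _ _ _) => T.
rewrite nth_last_index ?bsize_in // nth_addable bi bj -cats1 count_cat /=.
have -> : (0 == z) = false by case: z z0.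
have -> : (x.-1.+1 == z) = (x == z) by rewrite prednK.
rewrite !addn0; have := cnt z z0; do !move: (nat_of_bool _) => ?; do !move: (count_mem z _) => ?.
lia.
Qed.

Lemma intpart_sym n : symmetric (@intpart_edge n).
Proof. by move=> mu nu; apply/idP/idP; apply: intpart_edge_rev. Qed.

Definition partition_graph (n : nat) : sgraph := SGraph (@intpart_sym n) (@intpart_irr n).

Section LocalInvariants.
Variables (n : nat) (la : partition_graph n).

Definition neighborhood_graph : sgraph := induced (neighbors la).

Definition omega_loc : nat :=
  \max_(C : {set partition_graph n} | (la \in C) && clique C) #|C|.

Definition dim_loc : nat := omega_loc - 1.

Definition star_type (C : {set partition_graph n}) : Prop :=
  exists i : 'I_(nblocks la), forall nu, nu \in C :\ la ->
  exists2 j : 'I_(nblocks la).+1, admissible i j & nu = transfer i j.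

Definition top_type (C : {set partition_graph n}) : Prop :=
  exists j : 'I_(nblocks la).+1, forall nu, nu \in C :\ la ->
  exists2 i : 'I_(nblocks la), admissible i j & nu = transfer i j.
End LocalInvariants.

(* Main.v *)
Require Import Defs.
From HB Require Import structures.
From mathcomp Require Import all_boot zify.

Set Implicit Arguments.
Unset Strict Implicit.
Unset Printing Implicit Defensive.

(** The idea is to read a partition through its conjugate.  Number the columns
    of the Ferrers diagram from 0 and let [column s k] be the height of column
    k.  A transfer takes the last box of a row of length x = s_i, which lies in
    column x - 1, and puts it at the end of a row of length y = s_j, that is in
    column y.  In terms of the conjugate partition an admissible transfer is
    thus the addition of e_y - e_(x-1) with y <> x - 1, where e_k are the unit
    vectors; conversely two partitions of n whose conjugates differ by some
    e_a - e_b with a <> b are adjacent ([intpart_edgeP]), because monotonicity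
    of the columns forces column b to end in a removable corner and column a in
    an addable one.

    Everything then reduces to linear algebra with unit vectors.
    - A transfer fails to be admissible in two ways only: the two rows
      coincide, which means i = j and m_i = 1, or the two columns coincide,
      which means j = i + 1 and s_i - s_(i+1) = 1 ([admissibleE]).
    - Distinct admissible pairs (i, j) give distinct neighbours, and the
      neighbours (i, j) and (k, l) differ by
      e_(s_l) - e_(s_k - 1) - e_(s_j) + e_(s_i - 1).  If i = k or j = l this
      is again a difference of two unit vectors; otherwise nothing cancels and
      the neighbours are not adjacent ([edge_transfers]).

    So the neighbourhood of the partition is the graph of rook moves on the set
    of admissible cells (i, j) of a t x (t + 1) board ([neighborhood_rook]),
    and this is also the line graph of the local admissibility graph
    ([line_graph_rook]).  Cells that pairwise share a row or a column all lie
    in one row or all in one column ([rook_clique]), which gives the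
    dichotomy of star and top cliques; the degree and the clique number follow
    by counting admissible cells in each row and each column of the board.
    Finally, the set of admissible cells is a function of the transfer type
    ([admissible_type]), so all these objects are. *)

(** * Moving a box between columns *)

(** The conjugate partition, with 0-based columns. *)
Definition column (s : seq nat) (k : nat) : nat := count (ltn k) s.

(** One box leaves column [b] and one enters column [a]; the equation is written
    additively because subtraction on [nat] truncates. *)
Definition box_move (s s' : seq nat) (a b : nat) : Prop :=
  forall k, column s' k + (k == b) = column s k + (k == a).

Lemma column_split s k : column s k = count_mem k.+1 s + column s k.+1.
Proof.
rewrite /column; elim: s => //= x s ->.
by rewrite addnACA; congr (_ + _); rewrite leq_eqVlt eq_sym; case: eqP => // ->; rewrite ltnn.
Qed.

Lemma column_anti s k : column s k.+1 <= column s k.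
Proof. by rewrite (column_split s k) leq_addl. Qed.

(** A sorted list without zeros is determined by its multiplicities, and these
    are the differences of consecutive columns. *)
Lemma column_inj n (mu nu : intpart n) : column mu =1 column nu -> mu = nu.
Proof.
move=> eq_col; apply/val_inj => /=.
have /and3P[smu mu0 _] := partsP mu; have /and3P[snu nu0 _] := partsP nu.
apply: (sorted_eq geq_trans geq_anti) => //; apply/allP => -[|z] _ /=.
  by rewrite (count_memPn mu0) (count_memPn nu0).
by apply/eqP/(@addIn (column mu z.+1)); rewrite -column_split !eq_col -column_split.
Qed.

(** Two moves out of the same column differ by a move between their targets, and
    two moves into the same column by a move between their sources: these give
    the edges inside a neighbourhood. *)
Lemma box_move_same_source s s1 s2 a c b :
  box_move s s1 a b -> box_move s s2 c b -> box_move s1 s2 c a.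
Proof. by move=> mv1 mv2 k; have := mv1 k; have := mv2 k; lia. Qed.

Lemma box_move_same_target s s1 s2 a b d :
  box_move s s1 a b -> box_move s s2 a d -> box_move s1 s2 b d.
Proof. by move=> mv1 mv2 k; have := mv1 k; have := mv2 k; lia. Qed.

Lemma box_move_uniq s s' a b c d :
  box_move s s' a b -> box_move s s' c d -> a != b -> c != d -> a = c /\ b = d.
Proof.
move=> mv mv' nab ncd.
have e k : (k == d) + (k == a) = (k == b) + (k == c).
  by have := mv k; have := mv' k; lia.
by have := e a; have := e b; rewrite !eqxx; do 4?[case: eqP => ? //=]; lia.
Qed.

(** Unless the sources or the targets coincide, the composite of the inverse of
    the first move with the second one gains two boxes and loses two, in columns
    where nothing cancels, and a single move gains and loses only one. *)
Lemma box_move_shared s s1 s2 a b c d p q :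
  box_move s s1 a b -> box_move s s2 c d -> box_move s1 s2 p q ->
  a != b -> c != d -> p != q -> a = c \/ b = d.
Proof.
move=> mv1 mv2 mv nab ncd npq.
have e k : (k == c) + (k == q) + (k == b) = (k == a) + (k == p) + (k == d).
  by have := mv1 k; have := mv2 k; have := mv k; lia.
have [->|nac] := eqVneq a c; [by left | right].
by have := e c; have := e b; rewrite !eqxx; do 4?[case: eqP => ? //=]; lia.
Qed.

Lemma column_filter_sort s k : column (sort geq [seq x <- s | 0 < x]) k = column s k.
Proof.
rewrite /column (permP (permEl (perm_sort _ _))) count_filter.
by apply: eq_count => x /=; case: x => [|x]; rewrite ?ltn0 ?andbT.
Qed.

(** Columns are sums over the rows, and for two different rows [r] and [a] the
    move is visible row by row: row [r] loses its box in column
    [(nth 0 s r).-1], row [a] gains one in column [nth 0 s a]. *)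
Lemma column_transfer_rows (s : seq nat) r a :
  r < size s -> a <= size s -> r != a -> 0 < nth 0 s r ->
  box_move s (transfer_rows s r a) (nth 0 s a) (nth 0 s r).-1.
Proof.
move=> ltr lea neq r0 k.
have col_mk f m : column (mkseq f m) k = \sum_(i < m) (k < f i).
  by rewrite -(sumn_mkseq (fun i => k < f i : nat)) /column -sumn_count -map_comp.
(* The extra empty row makes room for the row that a transfer may create. *)
have -> : column s k = column (mkseq (nth 0 s) (size s).+1) k.
  by rewrite mkseq_nth0 /column -cats1 count_cat /= !addn0.
rewrite /transfer_rows !col_mk.
have pick1 c (b : nat) : c < (size s).+1 -> \sum_(i < (size s).+1) (val i == c) * b = b.
  by move=> ltc; rewrite -big_distrl /= sum_ord_eq1 // mul1n.
(* Spread each unit of the box move over the rows, concentrated in its row. *)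
rewrite -(pick1 r (k == (nth 0 s r).-1)); last exact: ltnW.
rewrite -(pick1 a (k == nth 0 s a)) // -!big_split /=.
apply: eq_bigr => i _; have [->|] := eqVneq (val i) r => /=.
  by rewrite (negbTE neq); lia.
by have [->|] := eqVneq (val i) a => /=; lia.
Qed.

(** * Transfers as box moves *)

Section Blocks.
Variables (n : nat) (la : intpart n).
Local Notation t := (nblocks la).

Lemma bsize_gt0 (i : 'I_t) : 0 < bsize la i.
Proof. exact: Defs.part_gt0 (bsize_in (ltn_ord i)). Qed.

Lemma bsize_decr i j : i < t -> i < j -> bsize la j < bsize la i.
Proof.
move=> lti ltij; have [ltj|lej] := ltnP j t; last first.
  by rewrite [X in X < _]/bsize nth_default ?(bsize_gt0 (Ordinal lti)).
have /and3P[sla _ _] := partsP la.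
have : sorted gtn (undup la).
  by rewrite gtn_sorted_uniq_geq undup_uniq (subseq_sorted geq_trans (undup_subseq _)).
have gtnT : transitive gtn by move=> x y z /= yx xz; apply: ltn_trans xz yx.
by move/(sorted_ltn_nth gtnT 0); apply.
Qed.

Lemma bsize_inj (i j : nat) : i <= t -> j <= t -> bsize la i = bsize la j -> i = j.
Proof.
move=> lei lej eqb; have [ltij|ltji|//] := ltngtP i j.
  by have := bsize_decr (leq_trans ltij lej) ltij; rewrite eqb ltnn.
by have := bsize_decr (leq_trans ltji lei) ltji; rewrite eqb ltnn.
Qed.

Lemma addable_inj : injective (fun j : 'I_t.+1 => bsize la j).
Proof. by move=> j l /bsize_inj eqjl; apply/val_inj/eqjl; rewrite -ltnS. Qed.

Lemma removable_inj : injective (fun i : 'I_t => (bsize la i).-1).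
Proof.
move=> i k eqb; apply/val_inj/(@bsize_inj i k); try exact: ltnW.
by have := bsize_gt0 i; have := bsize_gt0 k; lia.
Qed.

(** Including [0], which is the size of the block that follows the last one. *)
Lemma bsize_surj x : (x == 0) || (x \in (la : seq nat)) ->
  exists j : 'I_t.+1, bsize la j = x.
Proof.
have [xla _|xla] := boolP (x \in (la : seq nat)).
  have ltx : index x (undup la) < t.+1 by rewrite ltnS index_size.
  by exists (Ordinal ltx); rewrite bsize_index.
by rewrite orbF => /eqP->; exists ord_max; rewrite /bsize nth_default.
Qed.

Lemma transfer_same_row (i : 'I_t) (j : 'I_t.+1) :
  removable_row la i = addable_row la j -> transfer (la := la) i j = la.
Proof.
move=> eqr; apply: column_inj => k; rewrite /= column_filter_sort -eqr.
rewrite transfer_rows_id ?nth_last_index ?bsize_in ?bsize_gt0 //.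
by rewrite /column -cats1 count_cat /= !addn0.
Qed.

Lemma transfer_box_move (i : 'I_t) (j : 'I_t.+1) :
  removable_row la i != addable_row la j ->
  box_move la (transfer (la := la) i j) (bsize la j) (bsize la i).-1.
Proof.
move=> neq k; rewrite /= column_filter_sort.
have := column_transfer_rows (last_index_lt (bsize_in (ltn_ord i)))
          (addable_row_le la j) neq.
by rewrite nth_last_index ?bsize_in // nth_addable; apply; apply: bsize_gt0.
Qed.

Lemma same_row_alpha (i : 'I_t) (j : 'I_t.+1) :
  removable_row la i = addable_row la j -> i = j :> nat /\ bmult la i = 1.
Proof.
move=> eqr; have bi := bsize_in (ltn_ord i).
have eqb : bsize la i = bsize la j.
  by rewrite -(nth_addable j) -eqr nth_last_index.
split; first by apply: bsize_inj eqb; rewrite -ltnS // ltnW // ltnS.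
by apply: index_last_index bi _; rewrite [RHS]eqr /addable_row eqb.
Qed.

(** If the two columns were equal, the transfer would not change any column. *)
Lemma admissible_box_move (i : 'I_t) (j : 'I_t.+1) : admissible (la := la) i j ->
  box_move la (transfer i j) (bsize la j) (bsize la i).-1 /\
  bsize la j != (bsize la i).-1.
Proof.
move=> adm.
have mv : box_move la (transfer i j) (bsize la j) (bsize la i).-1.
  by apply: transfer_box_move; apply: contraNneq adm => /transfer_same_row->.
split=> //; apply: contraNneq adm => eqb; apply/eqP/column_inj => k.
by have := mv k; rewrite eqb => /addIn.
Qed.

(** For a block with one row, a genuine box move from it to itself would make
    column [bsize i] higher than column [(bsize i).-1]; so the two rows must
    coincide there and nothing moves.  In the other excluded case the box leaves
    and enters the same column.  In all remaining cases the two rows differ, and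
    the columns differ since block sizes decrease strictly. *)
Lemma admissibleE (i : 'I_t) (j : 'I_t.+1) :
  admissible i j = ~~ ((j == i :> nat) && (alpha la i == 1)) &&
                   ~~ ((j == i.+1 :> nat) && (beta la i == 1)).
Proof.
have i0 := bsize_gt0 i; rewrite /alpha /beta !eqb1.
apply/idP/andP => [adm|[/negP nal /negP nbe]].
  have [mv neq] := admissible_box_move adm; split; apply/negP.
    case/andP=> /eqP eqij /eqP mult1; have := column_split la (bsize la i).-1.
    have := column_anti (transfer i j) (bsize la i).-1.
    have := mv (bsize la i).-1; have := mv (bsize la i).
    rewrite prednK // -/(bmult la i) mult1 eqij eqxx.
    by do 2!case: eqP => ? //=; lia.
  by case/andP=> /eqP eqj /eqP; rewrite -eqj; move: neq => /eqP; lia.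
have neq : removable_row la i != addable_row la j.
  by apply/eqP => /same_row_alpha[eqij mult1]; apply: nal; rewrite mult1 eqij !eqxx.
have mv := transfer_box_move neq.
apply/eqP => eqT; apply: nbe; have := mv (bsize la j); rewrite eqT eqxx.
case: eqP => [eqb _|]; last by lia.
(* The columns coincide, so block [j] is exactly one shorter than block [i]; with
   strictly decreasing sizes, [j] must be the next block. *)
have ltij : i < j.
  rewrite ltnNge; apply/negP => leji; have [eqji|ltji] := eqVneq (j : nat) i.
    by move: eqb; rewrite eqji; lia.
  by have := @bsize_decr j i; move: leji ltji (ltn_ord i); lia.
have [ltSij|leSij] := ltnP i.+1 j.
  have := @bsize_decr i i.+1 (ltn_ord i) (leqnn _).
  have := @bsize_decr i.+1 j (leq_ltn_trans ltSij (ltn_ord j)) ltSij; lia.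
have eqj : j = i.+1 :> nat by lia.
by rewrite eqj eqxx -eqj eqb; apply/eqP; lia.
Qed.

Lemma transfer_inj (i k : 'I_t) (j l : 'I_t.+1) :
  admissible i j -> admissible k l -> transfer i j = transfer k l ->
  i = k /\ j = l.
Proof.
move=> /admissible_box_move[mv neq] /admissible_box_move[mv' neq'] eqT.
have [] := box_move_uniq mv _ neq neq'; first by rewrite eqT.
by move=> /addable_inj-> /removable_inj->.
Qed.
End Blocks.

(** Conversely to [admissible_box_move], any box move between two partitions is
    a transfer: monotonicity of the columns of [nu] forces a drop in the columns
    of [mu] after [b] and, when [a > 0], before [a], so [b.+1] and [a] are part
    sizes of [mu].  This makes adjacency a relation between conjugate
    partitions, free of the corners of either partition. *)
Lemma intpart_edgeP n (mu nu : intpart n) :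
  intpart_edge mu nu <-> exists a b, a != b /\ box_move mu nu a b.
Proof.
split=> [/andP[_ /existsP[i /existsP[j /andP[adm /eqP->]]]]|[a [b [neq mv]]]].
  by have [mv neq] := admissible_box_move adm; exists (bsize mu j), (bsize mu i).-1.
have diff : nu <> mu.
  by move=> eqn; have := mv a; rewrite eqn eqxx (negbTE neq); lia.
have mem_col x : column mu x.+1 < column mu x -> x.+1 \in (mu : seq nat).
  by rewrite -has_pred1 has_count (column_split mu x) -[X in X < _]add0n ltn_add2r.
have anti := column_anti nu.
have [/= j bj] : exists j : 'I_(nblocks mu).+1, bsize mu j = a.
  apply: bsize_surj; case: a neq mv => //= a neq mv; apply: mem_col.
  have := anti a; have := mv a; have := mv a.+1; rewrite eqxx (negbTE neq).
  by rewrite (ltn_eqF (ltnSn a)); lia.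
have bmu : b.+1 \in (mu : seq nat).
  apply: mem_col; have := anti b; have := mv b; have := mv b.+1.
  by rewrite eqxx [b == a]eq_sym (negbTE neq); rewrite (gtn_eqF (ltnSn b)); lia.
have [k bk] : exists k : 'I_(nblocks mu).+1, bsize mu k = b.+1.
  by apply: bsize_surj; rewrite bmu orbT.
have ltk : k < nblocks mu.
  by rewrite ltnNge; apply/negP => lek; move: bk; rewrite /bsize nth_default.
pose i := Ordinal ltk; have bi : bsize mu i = b.+1 by [].
have rows : removable_row mu i != addable_row mu j.
  apply/eqP => /same_row_alpha[eqij]; rewrite /bmult bi => mult1.
  have ab : a = b.+1 by rewrite -bi -bj eqij.
  have := column_split mu b; have := anti b; have := mv b; have := mv b.+1.
  rewrite mult1 -ab eqxx [b == a]eq_sym (negbTE neq).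
  by rewrite eqxx; lia.
have eqn : nu = transfer i j.
  apply: column_inj => z; apply: (@addIn (z == b)).
  by rewrite mv; have := transfer_box_move rows z; rewrite bi bj.
apply/andP; split; first by rewrite eq_sym; apply/eqP.
apply/existsP; exists i; apply/existsP; exists j.
by rewrite /admissible -eqn eqxx andbT; apply/eqP.
Qed.

Lemma edge_to_transfer n (la : intpart n) (i : 'I_(nblocks la)) (j : 'I_(nblocks la).+1) :
  admissible i j -> intpart_edge la (transfer i j).
Proof.
move=> adm; apply/andP; split; first by rewrite eq_sym.
by apply/existsP; exists i; apply/existsP; exists j; rewrite adm eqxx.
Qed.

(** The heart of the theorem: inside a neighbourhood, adjacency means sharing the
    removable corner or the addable corner. *)
Lemma edge_transfers n (la : intpart n) (i k : 'I_(nblocks la))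
    (j l : 'I_(nblocks la).+1) :
  admissible i j -> admissible k l ->
  intpart_edge (transfer i j) (transfer k l) =
  ((i, j) != (k, l)) && ((i == k) || (j == l)).
Proof.
move=> adm adm'; have [[-> ->]|/= neq] := eqVneq (i, j) (k, l).
  exact: intpart_irr.
have [mv nab] := admissible_box_move adm.
have [mv' ncd] := admissible_box_move adm'.
apply/idP/orP => [/intpart_edgeP[a [b [npq mvT]]]|].
  have [/addable_inj-> | /removable_inj->] :=
    box_move_shared mv mv' mvT nab ncd npq; by [right | left].
case=> /eqP eqx; apply/intpart_edgeP.
  subst k; exists (bsize la l), (bsize la j); split.
    by rewrite (inj_eq (@addable_inj _ la)); apply: contraNneq neq => ->.
  exact: box_move_same_source mv mv'.
subst l; exists (bsize la i).-1, (bsize la k).-1; split.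
  by rewrite (inj_eq (@removable_inj _ la)); apply: contraNneq neq => ->.
exact: box_move_same_target mv mv'.
Qed.

(** * Rook graphs and line graphs of bipartite graphs *)

Lemma graph_iso_sym G H : graph_iso G H -> graph_iso H G.
Proof.
case=> f [g fK gK] fE; exists g; first by exists f.
by move=> x y; rewrite -fE !gK.
Qed.

Lemma graph_iso_trans G H K : graph_iso G H -> graph_iso H K -> graph_iso G K.
Proof.
case=> f fb fE [g gb gE]; exists (g \o f); first exact: bij_comp.
by move=> x y; rewrite /= gE fE.
Qed.

Lemma inj_surj_bij (S T : finType) (f : S -> T) :
  injective f -> (forall y, exists x, f x = y) -> bijective f.
Proof.
move=> f_inj f_surj; apply: (inj_card_bij f_inj).
rewrite -(card_codom f_inj) subset_leq_card //; apply/subsetP=> y _.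
by have [x <-] := f_surj y; apply: codom_f.
Qed.

Section Relation.
Variables (a b : nat) (R : 'I_a -> 'I_b -> bool).

(** Cells [p] with [R p.1 p.2] on an [a] x [b] board, with the moves of a rook.
    This is the line graph of [bipartite R] with its edges presented as pairs,
    and is easier to map to neighbours of a partition. *)
Definition rook_edge : rel {p : 'I_a * 'I_b | R p.1 p.2} := fun p q =>
  (p != q) && (((val p).1 == (val q).1) || ((val p).2 == (val q).2)).

Lemma rook_sym : symmetric rook_edge.
Proof. by move=> p q; rewrite /rook_edge eq_sym ![(val q).1 == _]eq_sym ![(val q).2 == _]eq_sym. Qed.

Lemma rook_irr : irreflexive rook_edge.
Proof. by move=> p; rewrite /rook_edge eqxx. Qed.

Definition rook_graph : sgraph := SGraph rook_sym rook_irr.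

Definition pair_edge (p : 'I_a * 'I_b) : {set 'I_a + 'I_b} := [set inl p.1; inr p.2].

Lemma pair_edge_inj : injective pair_edge.
Proof.
move=> [i j] [k l] /setP e; congr (_, _).
  by have := e (inl i); rewrite !inE eqxx => /esym/orP[] /eqP[].
by have := e (inr j); rewrite !inE eqxx orbT => /esym/orP[] /eqP[].
Qed.

(** The set [e] is typed over the sum, not over the vertices of [bipartite R],
    so that the lemma applies to bipartite graphs of different relations on the
    same vertices. *)
Lemma bip_edgesP (e : {set 'I_a + 'I_b}) :
  reflect (exists2 p, R p.1 p.2 & e = pair_edge p) (e \in edges (bipartite R)).
Proof.
apply: (iffP idP) => [|[[i j] /= Rij ->]]; rewrite inE; last first.
  by apply/existsP; exists (inl i); apply/existsP; exists (inr j); rewrite /= Rij eqxx.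
case/existsP=> -[i|j] /existsP[[k|l]] //= /andP[Re /eqP->].
  by exists (i, l).
by exists (k, j); rewrite // setUC.
Qed.

Lemma pair_edge_meet p q :
  (pair_edge p :&: pair_edge q != set0) = (p.1 == q.1) || (p.2 == q.2).
Proof.
apply/set0Pn/orP => [[[i|j]]|[] /eqP e].
- by rewrite !inE /= !orbF => /andP[/eqP[->] /eqP[->]]; left.
- by rewrite !inE /= => /andP[/eqP[->] /eqP[->]]; right.
- by exists (inl p.1); rewrite !inE e eqxx.
by exists (inr p.2); rewrite !inE e eqxx !orbT.
Qed.

Lemma line_graph_rook : graph_iso rook_graph (line_graph (bipartite R)).
Proof.
have eP (p : {p : 'I_a * 'I_b | R p.1 p.2}) :
    (pair_edge (val p) : {set bipartite R}) \in edges (bipartite R).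
  by apply/bip_edgesP; exists (val p); first exact: valP p.
pose f (p : rook_graph) : line_graph (bipartite R) := Sub (pair_edge (val p)) (eP p).
have f_inj : injective f.
  by move=> p q /(congr1 val)/pair_edge_inj/val_inj.
exists f.
  apply: inj_surj_bij f_inj _ => e.
  have [p Rp eE] := bip_edgesP _ (valP e).
  by exists (Sub p Rp); apply: val_inj; rewrite /= -eE.
move=> p q; rewrite /edge /= /line_edge /rook_edge (inj_eq f_inj) /=.
by rewrite pair_edge_meet.
Qed.

Definition row_degree (i : 'I_a) := #|[set j | R i j]|.
Definition column_degree (j : 'I_b) := #|[set i | R i j]|.

(** The name anticipates [rook_clique]: the cliques of the rook graph are the
    subsets of the rows and of the columns of the board. *)
Definition rook_clique_number : nat :=
  maxn (\max_i row_degree i) (\max_j column_degree j).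

(** If some [q] is not in the row of [p], it is in the column of [p]; a cell that
    meets both [p] and [q] lies in that column as well, since it cannot be in
    both their rows.  The cell [p0] only provides a row when [S] is empty. *)
Lemma rook_clique (S : {set 'I_a * 'I_b}) (p0 : 'I_a * 'I_b) :
  {in S &, forall p q, (p.1 == q.1) || (p.2 == q.2)} ->
  (exists i, {in S, forall p, p.1 = i}) \/ (exists j, {in S, forall p, p.2 = j}).
Proof.
move=> cliqueS; have [->|[p pS]] := set_0Vmem S.
  by left; exists p0.1 => p; rewrite inE.
have [/forall_inP row|] := boolP [forall q in S, q.1 == p.1].
  by left; exists p.1 => q /row/eqP.
case/forall_inPn=> q qS neq; right; exists p.2 => r rS; apply/eqP.
have := cliqueS _ _ qS pS; rewrite (negbTE neq) /= => /eqP eqp.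
have := cliqueS _ _ rS pS; have := cliqueS _ _ rS qS; rewrite eqp.
by case: (r.2 == p.2); rewrite // !orbF => /eqP->; rewrite (negbTE neq).
Qed.
End Relation.

Section SameRelation.
Variables (a b : nat) (R R' : 'I_a -> 'I_b -> bool).
Hypothesis eqR : R =2 R'.

Lemma bipartite_eq : graph_iso (bipartite R) (bipartite R').
Proof.
exists id; first by exists id.
by move=> [i|j] [k|l]; rewrite /edge //= eqR.
Qed.

Lemma rook_graph_eq : graph_iso (rook_graph R) (rook_graph R').
Proof.
have eP (p : {p : 'I_a * 'I_b | R p.1 p.2}) : R' (val p).1 (val p).2.
  by rewrite -eqR; apply: valP p.
pose f (p : rook_graph R) : rook_graph R' := Sub (val p) (eP p).
have f_inj : injective f by move=> p q /(congr1 val) e; apply: val_inj; apply: e.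
exists f; last by move=> p q; rewrite /edge /= /rook_edge (inj_eq f_inj).
apply: inj_surj_bij f_inj _ => -[p pR].
have Rp : R p.1 p.2 by rewrite eqR.
by exists (exist _ p Rp); apply: val_inj.
Qed.

Lemma rook_clique_number_eq : rook_clique_number R = rook_clique_number R'.
Proof.
by congr maxn; apply: eq_bigr => x _; apply: eq_card => y; rewrite !inE eqR.
Qed.
End SameRelation.

(** * The neighbourhood as a rook graph *)

Lemma card_set_sum (T : finType) (P : pred T) : #|[set x | P x]| = \sum_x P x.
Proof. by rewrite -sum1_card big_mkcond; apply: eq_bigr => x _; rewrite inE; case: P. Qed.

Section Neighborhood.
Variables (n : nat) (la : partition_graph n).
Local Notation t := (nblocks (la : intpart n)).
Local Notation adm := (@admissible n la).

Definition transfer_pair (p : 'I_t * 'I_t.+1) : partition_graph n := transfer p.1 p.2.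

Lemma neighborsP mu :
  reflect (exists2 p, adm p.1 p.2 & mu = transfer_pair p) (mu \in neighbors la).
Proof.
rewrite inE; apply: (iffP andP) => [[_ /existsP[i /existsP[j]]]|[p pA ->]].
  by case/andP=> ij /eqP->; exists (i, j).
exact/andP/edge_to_transfer.
Qed.

Lemma transfer_pair_inj :
  {in [set p : 'I_t * 'I_t.+1 | adm p.1 p.2] &, injective transfer_pair}.
Proof.
move=> [i j] [k l]; rewrite !inE /transfer_pair /= => ij kl eqT.
by have [-> ->] := transfer_inj ij kl eqT.
Qed.

Lemma neighborhood_rook : graph_iso (rook_graph adm) (neighborhood_graph la).
Proof.
have eP (p : {p : 'I_t * 'I_t.+1 | adm p.1 p.2}) :
    transfer_pair (val p) \in neighbors la.
  by apply/neighborsP; exists (val p); first exact: valP p.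
pose f (p : rook_graph adm) : neighborhood_graph la := Sub (transfer_pair (val p)) (eP p).
have f_inj : injective f.
  by move=> p q /(congr1 val)/transfer_pair_inj e; apply/val_inj/e; rewrite inE (valP p, valP q).
exists f.
  apply: inj_surj_bij f_inj _ => mu.
  have /neighborsP[p pA muE] := valP mu.
  by exists (exist _ p pA); apply: val_inj; rewrite muE.
move=> [[i j] /= pA] [[k l] /= qA].
by rewrite /edge /= /induced_edge /= /edge /= edge_transfers.
Qed.

Lemma degree_admissible : degree la = \sum_i row_degree adm i.
Proof.
have -> : degree la = #|transfer_pair @: [set p : 'I_t * 'I_t.+1 | adm p.1 p.2]|.
  apply: eq_card => mu; apply/neighborsP/imsetP => -[p pA ->]; exists p => //.
    by rewrite inE.
  by move: pA; rewrite inE.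
rewrite card_in_imset; last exact: transfer_pair_inj.
under eq_bigr do rewrite /row_degree -sum1_card.
rewrite -sum1_card pair_big_dep /=; apply: eq_bigl => p.
by rewrite !inE.
Qed.

(** The cells of the neighbours in [C] form a clique of the rook graph. *)
Lemma clique_star_or_top (C : {set partition_graph n}) :
  0 < t -> la \in C -> clique C -> star_type la C \/ top_type la C.
Proof.
move=> t_gt0 laC /forall_inP cliqueC.
have edgeC x y : x \in C -> y \in C -> x != y -> edge x y.
  by move=> xC yC; have /forall_inP/(_ y yC)/implyP := cliqueC x xC.
pose S := [set p : 'I_t * 'I_t.+1 | adm p.1 p.2 & transfer_pair p \in C].
have CS nu : nu \in C :\ la -> exists2 p, p \in S & nu = transfer_pair p.
  case/setD1P=> nula nuC.
  have : nu \in neighbors la by rewrite inE edgeC // eq_sym.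
  case/neighborsP=> p pA nuE.
  by exists p; rewrite // inE pA -nuE.
have cliqueS : {in S &, forall p q, (p.1 == q.1) || (p.2 == q.2)}.
  move=> [i j] [k l]; rewrite !inE => /andP[pA pC] /andP[qA qC].
  have [[-> ->]|neq] := eqVneq (i, j) (k, l); first by rewrite eqxx.
  suff : edge (transfer_pair (i, j)) (transfer_pair (k, l)).
    by rewrite /edge /= edge_transfers // => /andP[].
  apply: edgeC => //; apply: contraNneq neq => eqT.
  by apply/eqP/transfer_pair_inj; rewrite ?inE.
case: (rook_clique (Ordinal t_gt0, ord0) cliqueS) => [[i Si]|[j Sj]].
  left; exists i => nu /CS[p pS ->]; exists p.2; rewrite -(Si p pS) //.
  by move: pS; rewrite inE => /andP[].
right; exists j => nu /CS[p pS ->]; exists p.1; rewrite -(Sj p pS) //.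
by move: pS; rewrite inE => /andP[].
Qed.

(** Neighbours in a rook clique are pairwise adjacent by [edge_transfers], and
    the partition itself can be added to them, whence the strict inequality. *)
Lemma clique_cone (A : {set 'I_t * 'I_t.+1}) :
  {in A, forall p, adm p.1 p.2} ->
  {in A &, forall p q, (p.1 == q.1) || (p.2 == q.2)} ->
  #|A| < omega_loc la.
Proof.
move=> admA rookA.
have laA : la \notin transfer_pair @: A.
  by apply/imsetP => -[p pA /esym/eqP]; apply/negP/admA.
have sA : A \subset [set p : 'I_t * 'I_t.+1 | adm p.1 p.2].
  by apply/subsetP=> p /admA; rewrite inE.
have -> : #|A|.+1 = #|la |: transfer_pair @: A|.
  rewrite cardsU1 laA card_in_imset // => p q pA qA.
  by apply: transfer_pair_inj; apply: (subsetP sA).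
apply: (@leq_bigmax_cond _ _ (fun C : {set partition_graph n} => #|C|)).
rewrite setU11 /=; apply/forall_inP=> x xC; apply/forall_inP=> y yC; apply/implyP.
case/setU1P: xC => [->|/imsetP[p pA ->]]; case/setU1P: yC => [->|/imsetP[q qA ->]].
- by rewrite eqxx.
- by move=> _; apply: edge_to_transfer; apply: admA.
- by move=> _; rewrite edge_sym; apply: edge_to_transfer; apply: admA.
move=> neq; case: p q pA qA neq => [i j] [k l] pA qA neq.
rewrite /edge /= edge_transfers; [|exact: admA pA|exact: admA qA].
rewrite (rookA _ _ pA qA) andbT.
by apply: contraNneq neq => ->.
Qed.

(** The upper bound is [clique_star_or_top]; the lower bound is [clique_cone]
    for a full row and for a full column of the board. *)
Lemma omega_loc_rook : 0 < t -> omega_loc la = (rook_clique_number adm).+1.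
Proof.
move=> t_gt0; apply/eqP; rewrite eqn_leq; apply/andP; split.
  apply/bigmax_leqP => C /andP[laC cliqueC].
  rewrite (cardsD1 la) laC ltnS leq_max.
  case: (clique_star_or_top t_gt0 laC cliqueC) => [[i Ci]|[j Cj]]; apply/orP.
    left; apply: (bigmax_sup i) => //.
    apply: leq_trans (leq_imset_card (fun j => transfer_pair (i, j)) _).
    apply/subset_leq_card/subsetP => nu /Ci[j ij ->].
    by apply: (imset_f (fun j => transfer_pair (i, j))); rewrite inE.
  right; apply: (bigmax_sup j) => //.
  apply: leq_trans (leq_imset_card (fun i => transfer_pair (i, j)) _).
  apply/subset_leq_card/subsetP => nu /Cj[i ij ->].
  by apply: (imset_f (fun i => transfer_pair (i, j))); rewrite inE.
have rows i : row_degree adm i < omega_loc la.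
  have pair_inj : injective (pair i : 'I_t.+1 -> _) by move=> j l [].
  rewrite /row_degree -(card_imset _ pair_inj); apply: clique_cone.
    by move=> p /imsetP[j]; rewrite inE => ij ->.
  by move=> p q /imsetP[j _ ->] /imsetP[l _ ->]; rewrite eqxx.
have cols j : column_degree adm j < omega_loc la.
  have pair_inj : injective (pair^~ j : 'I_t -> _) by move=> i k [].
  rewrite /column_degree -(card_imset _ pair_inj); apply: clique_cone.
    by move=> p /imsetP[i]; rewrite inE => ij ->.
  by move=> p q /imsetP[i _ ->] /imsetP[k _ ->]; rewrite eqxx orbT.
have om_gt0 : 0 < omega_loc la := leq_ltn_trans (leq0n _) (rows (Ordinal t_gt0)).
rewrite -(prednK om_gt0) ltnS geq_max.
by apply/andP; split; apply/bigmax_leqP => x _; rewrite -ltnS (prednK om_gt0).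
Qed.

Lemma alpha_le1 i : alpha la i <= 1. Proof. exact: leq_b1. Qed.
Lemma beta_le1 i : beta la i <= 1. Proof. exact: leq_b1. Qed.

(** The two possible obstructions in row [i] sit in the distinct cells [(i, i)]
    and [(i, i.+1)], so each cell of the row is counted exactly once. *)
Lemma row_degreeE (i : 'I_t) :
  row_degree adm i + alpha la i + beta la i = t.+1.
Proof.
have -> : row_degree adm i = \sum_(j < t.+1) adm i j.
  exact: card_set_sum.
have pick1 (f : nat) c : c < t.+1 -> f = \sum_(j < t.+1) (val j == c) * f.
  by move=> ltc; rewrite -big_distrl /= sum_ord_eq1 // mul1n.
rewrite [X in _ + X + _](pick1 _ i) ?ltnS ?(ltnW (ltn_ord i)) //.
rewrite [X in _ + X](pick1 _ i.+1) ?ltnS //.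
rewrite -!big_split /= -[RHS]card_ord -sum1_card; apply: eq_bigr => j _.
rewrite admissibleE; move: (alpha_le1 i) (beta_le1 i).
by do 2![case: eqP => ? /=]; lia.
Qed.

(** As for rows, with the obstructions in the cells [(j, j)] and [(j.-1, j)], of
    which the first is off the board for the last column and the second for the
    first one. *)
Lemma column_degreeE (j : 'I_t.+1) :
  column_degree adm j + (if j < t then alpha la j else 0)
                      + (if 0 < j then beta la j.-1 else 0) = t.
Proof.
have -> : column_degree adm j = \sum_(i < t) adm i j.
  exact: card_set_sum.
have -> : (if j < t then alpha la j else 0) = \sum_(i < t) (val i == j) * alpha la j.
  rewrite -big_distrl /=; case: ifP => [ltj|/negbT]; first by rewrite sum_ord_eq1 // mul1n.
  by rewrite -leqNgt => lej; rewrite big1 // => i _; have := ltn_ord i; lia.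
have -> : (if 0 < j then beta la j.-1 else 0) =
          \sum_(i < t) (val i == j.-1) * ((0 < j) * beta la j.-1).
  case: ifP => [j0|_]; last by rewrite big1 // => i _; rewrite muln0.
  rewrite -big_distrl /= sum_ord_eq1 ?mul1n //.
  by rewrite -ltnS prednK.
rewrite -!big_split /= -[RHS]card_ord -sum1_card; apply: eq_bigr => i _.
rewrite admissibleE; move: (alpha_le1 i) (beta_le1 i).
have [eqj|nej] := eqVneq (j : nat) i.
  by rewrite eqj; case: (posnP i) => [->|i0]; do !case: eqP => ? /=; lia.
have [eqj|neSj] := eqVneq (j : nat) i.+1.
  by rewrite eqj /=; do !case: eqP => ? /=; lia.
by do !case: eqP => ? /=; lia.
Qed.

Lemma dim_loc_rook : 0 < t -> dim_loc la = rook_clique_number adm.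
Proof. by move=> t_gt0; rewrite /dim_loc omega_loc_rook // subn1. Qed.
End Neighborhood.

(** * Dependence on the transfer type *)

(** Admissibility computed from a transfer type alone.  Since the size of the
    board is also read off from [tau], two partitions with equal types have the
    same board, without any cast between ordinal types. *)
Definition type_admissible (tau : nat * seq nat * seq nat)
    (i : 'I_tau.1.1) (j : 'I_tau.1.1.+1) : bool :=
  ~~ ((j == i :> nat) && (nth 0 tau.1.2 i == 1)) &&
  ~~ ((j == i.+1 :> nat) && (nth 0 tau.2 i == 1)).

Lemma admissible_type n (la : intpart n) :
  @admissible n la =2 @type_admissible (transfer_type la).
Proof. by move=> i j; rewrite admissibleE /type_admissible /= !nth_mkseq. Qed.

Lemma edges_bipartite_type n (la : intpart n) (t := nblocks la) :
  edges (local_graph la) =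
    edges (complete_bipartite t t.+1)
      :\: ([set [set inl i; inr (widen_ord (leqnSn t) i)]
             | i : 'I_t & alpha la i == 1]
           :|: [set [set inl i; inr (lift ord0 i)]
             | i : 'I_t & beta la i == 1]).
Proof.
apply/setP=> e; rewrite in_setD; apply/bip_edgesP/andP => [[[i j] /= ij ->]|[]].
  move: ij; rewrite admissibleE => /andP[nal nbe]; split; last first.
    by apply/bip_edgesP; exists (i, j).
  rewrite inE negb_or; apply/andP; split; apply/imsetP => -[k].
    rewrite inE => al /(@pair_edge_inj _ _ (i, j) (k, _))[eqi eqj].
    by move: nal; rewrite eqi eqj /= eqxx al.
  rewrite inE => be /(@pair_edge_inj _ _ (i, j) (k, _))[eqi eqj].
  by move: nbe; rewrite eqi eqj /= eqxx be.
move=> ndel /(@bip_edgesP t t.+1 (fun _ _ => true))[[i j] _ eE]; exists (i, j) => //=.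
rewrite admissibleE -negb_or; apply: contra ndel => del; rewrite inE {}eE.
apply/orP; case/orP: del => /andP[/eqP eqj ab]; [left | right].
  apply/imsetP; exists i; rewrite ?inE //; congr [set _; inr _].
  exact: val_inj.
apply/imsetP; exists i; rewrite ?inE //; congr [set _; inr _].
exact: val_inj.
Qed.

Lemma nblocks_gt0 n (la : intpart n) : 0 < n -> 0 < nblocks la.
Proof.
move=> n_gt0; have /and3P[_ _ /eqP] := partsP la.
rewrite /nblocks; case: (la : seq nat) => [|x s] sla; first by rewrite -sla in n_gt0.
have : x \in undup (x :: s) by rewrite mem_undup mem_head.
by case: (undup _).
Qed.

Section TypeInvariants.
Variables (n : nat) (la : intpart n).
Local Notation type_rel := (@type_admissible (transfer_type la)).

Lemma local_graph_type : graph_iso (local_graph la) (bipartite type_rel).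
Proof. exact: bipartite_eq (@admissible_type n la). Qed.

Lemma neighborhood_graph_type :
  graph_iso (neighborhood_graph la) (rook_graph type_rel).
Proof.
apply: graph_iso_trans (graph_iso_sym (neighborhood_rook _)) _.
exact: rook_graph_eq (@admissible_type n la).
Qed.

Lemma degree_type :
  degree (G := partition_graph n) la = \sum_i row_degree type_rel i.
Proof.
rewrite degree_admissible; apply: eq_bigr => i _.
by apply: eq_card => j; rewrite !inE admissible_type.
Qed.

Lemma omega_loc_type : 0 < n -> omega_loc la = (rook_clique_number type_rel).+1.
Proof.
move=> n_gt0; rewrite omega_loc_rook ?nblocks_gt0 //.
by rewrite (rook_clique_number_eq (@admissible_type n la)).
Qed.
End TypeInvariants.

Theorem theorem7p1 (n : nat) (n_ge1 : 1 <= n) (la : intpart n) :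
  let t := nblocks la in
  [/\ forall (k : nat) (k_ge1 : 1 <= k) (mu : intpart k),
        transfer_type la = transfer_type mu ->
        [/\ graph_iso (local_graph la) (local_graph mu),
            graph_iso (neighborhood_graph la) (neighborhood_graph mu),
            degree (G := partition_graph n) la =
              degree (G := partition_graph k) mu,
            omega_loc la = omega_loc mu
          & dim_loc la = dim_loc mu],
      edges (local_graph la) =
        edges (complete_bipartite t t.+1)
          :\: ([set [set inl i; inr (widen_ord (leqnSn t) i)]
                 | i : 'I_t & alpha la i == 1]
               :|: [set [set inl i; inr (lift ord0 i)]
                 | i : 'I_t & beta la i == 1]),
      graph_iso (neighborhood_graph la) (line_graph (local_graph la)),
      forall C : {set partition_graph n},
        la \in C -> clique C -> star_type la C \/ top_type la C
    & degree (G := partition_graph n) la =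
        t * t.+1 - \sum_(i < t) alpha la i - \sum_(i < t) beta la i
      /\
      dim_loc la =
        maxn (\max_(i < t) (t + 1 - alpha la i - beta la i))
             (\max_(j < t.+1) (t - (if j < t then alpha la j else 0)
                                 - (if 0 < j then beta la j.-1 else 0)))].
Proof.
move=> t; have t_gt0 : 0 < t := nblocks_gt0 la n_ge1.
split.
- move=> k k_ge1 mu eq_type.
  have eq_omega : omega_loc la = omega_loc mu.
    by rewrite !omega_loc_type // eq_type.
  split=> //; last by rewrite /dim_loc eq_omega.
  + apply: graph_iso_trans (local_graph_type la) _; rewrite eq_type.
    exact: graph_iso_sym (local_graph_type mu).
  + apply: graph_iso_trans (neighborhood_graph_type la) _; rewrite eq_type.
    exact: graph_iso_sym (neighborhood_graph_type mu).
  by rewrite !degree_type eq_type.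
- exact: edges_bipartite_type.
- exact: graph_iso_trans (graph_iso_sym (neighborhood_rook _)) (line_graph_rook _).
- by move=> C; apply: clique_star_or_top.
split.
  have sum_rows : \sum_(i < t) (row_degree (@admissible n la) i + alpha la i + beta la i)
                  = t * t.+1.
    by under eq_bigr do rewrite row_degreeE; rewrite sum_nat_const card_ord.
  rewrite degree_admissible -sum_rows !big_split /=.
  by rewrite -[_ - _ - _]subnDA -addnA addnK.
rewrite dim_loc_rook //; congr maxn; apply: eq_bigr => x _.
  by have := row_degreeE x; rewrite -/t; lia.
by rewrite -[X in X - _ - _](column_degreeE x) -subnDA -addnA addnK.
Qed.
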